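(* Let $M$ be a closed smooth manifold, $V$ a smooth vector field on $M$, $\Phi:M\times\mathbf{R}\to M$ the flow generated by $V$, and $Y\subset M$ a closed flow-invariant subset. Assume that there exists a Lyapunov 1-form for $(\Phi,Y)$ lying in a cohomology class $\xi\in H^1(M;\mathbf{R})$. Then $$\langle \xi, \mathcal{A}_\mu\rangle \leq 0$$ for any $\Phi$-invariant positive finite Borel measure $\mu$ on $M$, where $\mathcal{A}_\mu\in H_1(M;\mathbf{R})$ is the asymptotic cycle of $\Phi$ corresponding to $\mu$; equality takes place if and only if the complement of $Y$ has $\mu$-measure zero. Further, the restriction of $\xi$ to $Y$, viewed as a Čech cohomology class $\xi|_Y\in\check H^1(Y;\mathbf{R})$, vanishes: $\xi|_Y=0$.
   Context: **Lyapunov 1-form.** A smooth closed 1-form $\omega$ on $M$ is a Lyapunov one-form for the pair $(\Phi,Y)$ if: ($\Lambda$1) the function $\iota_V(\omega)=\omega(V)$ is negative on $M-Y$; and ($\Lambda$2) there exists a smooth function $f:U\to\mathbf{R}$ defined on an open neighborhood $U$ of $Y$ such that $\omega|_U=df$ and $df|_Y=0$ (i.e. the differential $df$ vanishes, as a covector, at each point of $Y$). It lies in the class $\xi$ if its de Rham class is $\xi$. **Asymptotic cycle.** For a $\Phi$-invariant finite Borel measure $\mu$ on $M$, the asymptotic cycle $\mathcal{A}_\mu=\mathcal{A}_\mu(\Phi)\in H_1(M;\mathbf{R})$ is the unique real homology class such that $\langle\xi,\mathcal{A}_\mu\rangle=\int_M\iota_V(\omega)\,d\mu$ for every $\xi\in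 H^1(M;\mathbf{R})$ and every smooth closed 1-form $\omega$ in the class $\xi$ (the integral depends only on $\xi$). **Čech cohomology.** For closed $Y\subset M$, $\check H^1(Y;\mathbf{R})=\varinjlim_{W\supset Y}H^1(W;\mathbf{R})$ (singular cohomology), where $W$ runs over open neighborhoods of $Y$ in $M$. Thus $\xi|_Y=0$ in $\check H^1(Y;\mathbf{R})$ means that $\xi|_W=0\in H^1(W;\mathbf{R})$ for some open neighborhood $W$ of $Y$. *)

(* Defs.v *)
From HB Require Import structures.
From mathcomp Require Import all_boot all_order all_algebra.
From mathcomp Require Import all_classical all_reals all_analysis.
From mathcomp Require Import freeg.

Set Implicit Arguments.
Unset Strict Implicit.
Unset Printing Implicit Defensive.

Import Order.TTheory GRing.Theory Num.Theory.
Import numFieldNormedType.Exports.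

Local Open Scope classical_set_scope.
Local Open Scope ring_scope.
Local Open Scope quotient_scope.

Section ker_mod_im.
Variables (U V W : zmodType) (a : {additive U -> V}) (b : {additive V -> W}).

Definition cycles := {v : V | b v == 0}.

Definition cycle_equiv (v w : cycles) : bool :=
  `[< exists u : U, val v - val w = a u >].

Fact cycle_equiv_refl : reflexive cycle_equiv.
Proof. by move=> v; apply/asboolP; exists 0; rewrite subrr raddf0. Qed.

Fact cycle_equiv_sym : symmetric cycle_equiv.
Proof.
have sub v w : cycle_equiv v w -> cycle_equiv w v.
  by move=> /asboolP[u vw]; apply/asboolP; exists (- u); rewrite raddfN -vw opprB.
by move=> v w; apply/idP/idP => /sub.
Qed.

Fact cycle_equiv_trans : transitive cycle_equiv.
Proof.
move=> w v x /asboolP[u vw] /asboolP[u' wx]; apply/asboolP; exists (u + u').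
by rewrite raddfD -vw -wx addrA subrK.
Qed.

Canonical cycle_equiv_rel :=
  EquivRel cycle_equiv cycle_equiv_refl cycle_equiv_sym cycle_equiv_trans.

Definition homology := {eq_quot cycle_equiv_rel}.

Fact cycle0_subproof : b 0 == 0. Proof. by rewrite raddf0. Qed.

Definition homology0 : homology := \pi_homology (exist _ 0 cycle0_subproof).

End ker_mod_im.

Section simplices.
Variable R : realType.

Definition simplex (k : nat) : set 'rV[R]_k.+1 :=
  [set t | (forall i, 0 <= t ord0 i) /\ \sum_i t ord0 i = 1].
Arguments simplex : clear implicits.

Fact vertex_subproof (k : nat) (i : 'I_k.+1) :
  delta_mx ord0 i \in simplex k.
Proof.
apply/mem_set; split=> [j|]; first by rewrite mxE ler0n.
rewrite (bigD1 i) //= mxE !eqxx big1 ?addr0 // => j /negbTE ji.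
by rewrite mxE ji andbF.
Qed.

Definition vertex (k : nat) (i : 'I_k.+1) : simplex k :=
  exist _ (delta_mx ord0 i) (vertex_subproof i).

Definition face_fun (k : nat) (i : 'I_k.+2) (t : 'rV[R]_k.+1) : 'rV[R]_k.+2 :=
  \row_j (if unlift i j is Some l then t ord0 l else 0).

Fact face_subproof (k : nat) (i : 'I_k.+2) (t : simplex k) :
  face_fun i (val t) \in simplex k.+1.
Proof.
have [t0 t1] := set_mem (valP t); apply/mem_set; split=> [j|].
  by rewrite mxE; case: unliftP.
rewrite (bigD1_ord i) //= mxE unlift_none add0r -t1.
by apply: eq_bigr => j _; rewrite mxE liftK.
Qed.

Definition face_map (k : nat) (i : 'I_k.+2) (t : simplex k) : simplex k.+1 :=
  exist _ (face_fun i (val t)) (face_subproof i t).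

Fact face_map_continuous (k : nat) (i : 'I_k.+2) : continuous (@face_map k i).
Proof.
apply: continuous_comp_initial => t A [P Pt PA].
have entry_cvg a j : (fun s : simplex k => face_fun i (val s) a j) @ t -->
    face_fun i (val t) a j.
  rewrite /face_fun mxE; under eq_fun do rewrite mxE.
  case: unliftP => [l _|_]; last first.
    by move=> B /nbhs_singleton B0; apply: (@nearW _ (nbhs t) (fun=> B 0)).
  apply: (@continuous_comp _ _ _ set_val (fun v : 'rV[R]_k.+1 => v ord0 l)).
    exact: initial_continuous.
  exact: coord_continuous.
have : \forall s \near t, forall a j, P a j (face_fun i (val s) a j).
  have F := nbhs_filter t.
  apply: (filter_forall (F := nbhs t)) => a.
  by apply: (filter_forall (F := nbhs t)) => j; apply/entry_cvg/Pt.
by apply: filterS => s Ps; apply: PA.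
Qed.

Definition face (k : nat) (i : 'I_k.+2) :
    continuousType (simplex k) (simplex k.+1) :=
  mkcts (@face_map_continuous k i).

End simplices.
Arguments simplex : clear implicits.
Arguments vertex R {k} i.
Arguments face R {k} i.

Definition singular (R : realType) (k : nat) (X : topologicalType) :=
  continuousType (simplex R k) X.

HB.instance Definition _ (R : realType) (k : nat) (X : topologicalType) :=
  Choice.on (singular R k X).

Definition comp_cts (X Y Z : topologicalType) (g : continuousType Y Z)
  (f : continuousType X Y) : continuousType X Z := g \o f.

Definition singular_face (R : realType) (k : nat) (X : topologicalType)
    (i : 'I_k.+2) (s : singular R k.+1 X) : singular R k X :=
  comp_cts s (face R i).

Section chains.
Variables (R : realType) (X : topologicalType).

Definition chain (k : nat) := {freeg (singular R k X) / R}.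
Definition cochain (k : nat) := singular R k X -> R.

HB.instance Definition _ k := GRing.Lmodule.on (chain k).
HB.instance Definition _ k := GRing.Lmodule.on (cochain k).

Definition boundary (k : nat) : chain k.+1 -> chain k :=
  fglift (fun s : singular R k.+1 X =>
    \sum_(i < k.+2) << (-1) ^+ i *g singular_face i s >> : chain k).

Fact boundary_additive (k : nat) : additive (@boundary k).
Proof. exact: lift_is_additive. Qed.

HB.instance Definition _ (k : nat) :=
  GRing.isAdditive.Build (chain k.+1) (chain k) (@boundary k)
    (@boundary_additive k).

Definition coboundary (k : nat) (z : cochain k) : cochain k.+1 :=
  fun s => \sum_(i < k.+2) (-1) ^+ i * z (singular_face i s).

Fact coboundary_additive (k : nat) : additive (@coboundary k).
Proof.
move=> z z'; apply/funext => s; rewrite /coboundary.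
rewrite [RHS](_ : _ = \sum_(i < k.+2) (-1) ^+ i * z (singular_face i s) -
  \sum_(i < k.+2) (-1) ^+ i * z' (singular_face i s)) // -sumrB.
by apply: eq_bigr => i _; rewrite -mulrBr.
Qed.

HB.instance Definition _ (k : nat) :=
  GRing.isAdditive.Build (cochain k) (cochain k.+1) (@coboundary k)
    (@coboundary_additive k).

Definition eval_cochain (k : nat) (z : cochain k) (c : chain k) : R :=
  fglift (z : singular R k X -> R^o) c.

Definition cocycle1 := cycles (@coboundary 1).
Definition homology1 := homology (@boundary 1) (@boundary 0).
Definition cohomology1 := homology (@coboundary 0) (@coboundary 1).

Definition kronecker (xi : cohomology1) (A : homology1) : R :=
  eval_cochain (val (repr xi)) (val (repr A)).

End chains.

Section pullback.
Variables (R : realType) (X Y : topologicalType) (h : continuousType X Y).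

Definition pull_cochain (k : nat) (z : cochain R Y k) : cochain R X k :=
  fun s => z (comp_cts h s).

Fact pull_cocycle_subproof (z : cocycle1 R Y) :
  coboundary (pull_cochain (val z)) == 0.
Proof.
apply/eqP/funext => s.
have zs : coboundary (val z) (comp_cts h s) = 0 by rewrite (eqP (valP z)).
rewrite -[RHS]zs; apply: eq_bigr => i _; congr (_ * val z _).
exact/continuousEP.
Qed.

Definition pull_cocycle (z : cocycle1 R Y) : cocycle1 R X :=
  exist _ (pull_cochain (val z)) (pull_cocycle_subproof z).

Definition pullback (xi : cohomology1 R Y) : cohomology1 R X :=
  \pi_(cohomology1 R X) (pull_cocycle (repr xi)).

End pullback.

Definition inclusion (X : topologicalType) (W : set X) : continuousType W X :=
  mkcts (@initial_continuous W X set_val).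

Definition restriction (R : realType) (X : topologicalType) (W : set X) :
    cohomology1 R X -> cohomology1 R W :=
  pullback (inclusion W).

(** The class of [xi] in the direct limit of [cohomology1 R W], over the open
    neighbourhoods [W] of [Y], is zero iff it is already zero on some [W]. *)
Definition cech_restriction_eq0 (R : realType) (X : topologicalType)
    (xi : cohomology1 R X) (Y : set X) : Prop :=
  exists W : set X, [/\ open W, Y `<=` W &
    restriction W xi = homology0 _ _].

Section smooth.
Variables (R : realType) (n : nat).

Definition basis_vec (i : 'I_n) : 'rV[R]_n := delta_mx ord0 i.

Definition partials (s : seq 'I_n) (f : 'rV[R]_n -> R) : 'rV[R]_n -> R :=
  foldr (fun i g x => 'D_(basis_vec i) g x) f s.

(** [U] is meant to be open: then this is [C^oo] on [U], and it depends only
    on the values of [f] on [U]. *)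
Definition smooth_on (U : set 'rV[R]_n) (f : 'rV[R]_n -> R) : Prop :=
  forall (s : seq 'I_n) (x : 'rV[R]_n), U x ->
    {for x, continuous (partials s f)} /\
    forall i, derivable (partials s f) x (basis_vec i).

End smooth.

Record chart (R : realType) (n : nat) (X : topologicalType) := Chart {
  dom : set X;
  coord : X -> 'rV[R]_n;
  param : 'rV[R]_n -> X;
  _ : open dom;
  _ : open (coord @` dom);
  _ : {in dom, cancel coord param};
  _ : {within dom, continuous coord};
  _ : {within coord @` dom, continuous param} }.

(** [transition c d] is the change of coordinates from [c] to [d]; it is
    meaningful on [overlap c d]. *)
Definition overlap (R : realType) (n : nat) (X : topologicalType)
    (c d : chart R n X) : set 'rV[R]_n :=
  coord c @` (dom c `&` dom d).

Definition transition (R : realType) (n : nat) (X : topologicalType)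
    (c d : chart R n X) : 'rV[R]_n -> 'rV[R]_n :=
  coord d \o param c.

(** Carriers are pointed, as the library requires of measurable spaces. *)
Record closedManifold (R : realType) (n : nat) := ClosedManifold {
  carrier :> ptopologicalType;
  manifold_hausdorff : hausdorff_space carrier;
  manifold_second_countable : @second_countable carrier;
  manifold_compact : compact [set: carrier];
  index : Type;
  atlas : index -> chart R n carrier;
  chart_at : carrier -> index;
  chart_atP : forall p, dom (atlas (chart_at p)) p;
  atlas_compat : forall i j k, smooth_on (overlap (atlas i) (atlas j))
    (fun y => transition (atlas i) (atlas j) y ord0 k) }.

Section manifold.
Variables (R : realType) (n : nat) (M : closedManifold R n).
Implicit Types (i j : index M) (p : M) (U Y : set M).

Local Notation jac i j p := ('J (transition (atlas i) (atlas j))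
  (coord (atlas i) p)).

Definition smooth_fun U (f : M -> R) : Prop :=
  forall i, smooth_on (coord (atlas i) @` (dom (atlas i) `&` U))
    (f \o param (atlas i)).

(** Tensor fields are given by their components in each chart of the atlas;
    [vf_comp V i p] matters only for [p] in the domain of chart [i].  With the
    row-vector convention of ['J], components of vectors transform by right
    multiplication by the Jacobian and those of covectors by left
    multiplication by the Jacobian in the opposite direction. *)
Record vectorField := VectorField {
  vf_comp : index M -> M -> 'rV[R]_n;
  vf_change : forall i j p, dom (atlas i) p -> dom (atlas j) p ->
    vf_comp j p = vf_comp i p *m jac i j p;
  vf_smooth : forall i k, smooth_on (coord (atlas i) @` dom (atlas i))
    (fun y => vf_comp i (param (atlas i) y) ord0 k) }.

Record oneForm := OneForm {
  form_comp : index M -> M -> 'cV[R]_n;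
  form_change : forall i j p, dom (atlas i) p -> dom (atlas j) p ->
    form_comp i p = jac i j p *m form_comp j p;
  form_smooth : forall i k, smooth_on (coord (atlas i) @` dom (atlas i))
    (fun y => form_comp i (param (atlas i) y) k ord0) }.

Implicit Types (V : vectorField) (w : oneForm).

(** The pairing [iota_V w]; its value does not depend on the chart at [p]. *)
Definition contraction V w p : R :=
  (vf_comp V (chart_at p) p *m form_comp w (chart_at p) p) ord0 ord0.

Definition closed_form w : Prop :=
  forall i k l x, (coord (atlas i) @` dom (atlas i)) x ->
    'D_(basis_vec R k) (fun y => form_comp w i (param (atlas i) y) l ord0) x =
    'D_(basis_vec R l) (fun y => form_comp w i (param (atlas i) y) k ord0) x.

Definition differential (f : M -> R) i p : 'cV[R]_n :=
  \col_k 'D_(basis_vec R k) (f \o param (atlas i)) (coord (atlas i) p).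

Definition primitive_on U w (f : M -> R) : Prop :=
  smooth_fun U f /\
  forall i p, dom (atlas i) p -> U p -> form_comp w i p = differential f i p.

(** The integral of a closed form along a continuous path, i.e. a singular
    1-simplex: [F] is a primitive along [s] when near every parameter it is
    the composite with [s] of a local primitive of the form, and the integral
    is the variation of [F]. *)
Definition primitive_along w (s : singular R 1 M) (F : simplex R 1 -> R) :
    Prop :=
  forall t, exists U f, [/\ open U, U (s t), primitive_on U w f &
    \forall t' \near t, F t' = f (s t')].

Definition path_integral w (s : singular R 1 M) (a : R) : Prop :=
  exists2 F, primitive_along w s F &
    a = F (vertex R ord_max) - F (vertex R ord0).

(** The de Rham isomorphism sends the class of a closed form to the class of
    the singular cocycle given by integration. *)
Definition in_class w (xi : cohomology1 R M) : Prop :=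
  exists2 z : cocycle1 R M, xi = \pi_(cohomology1 R M) z &
    forall s, path_integral w s (val z s).

Definition flow_generated_by V (Phi : M * R -> M) : Prop :=
  [/\ continuous Phi,
      forall p, Phi (p, 0) = p,
      forall p s t, Phi (Phi (p, s), t) = Phi (p, s + t) &
      forall p t i, dom (atlas i) (Phi (p, t)) ->
        is_derive t 1 (fun s => coord (atlas i) (Phi (p, s)))
          (vf_comp V i (Phi (p, t)))].

Definition flow_invariant (Phi : M * R -> M) Y : Prop :=
  forall p t, Y p -> Y (Phi (p, t)).

Definition lyapunov_form V Y w : Prop :=
  [/\ closed_form w,
      forall p, ~ Y p -> contraction V w p < 0 &
      exists U f, [/\ open U, Y `<=` U, primitive_on U w f &
        forall i p, dom (atlas i) p -> Y p -> differential f i p = 0]].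

Definition borel := g_sigma_algebraType (@open M).

HB.instance Definition _ := Measurable.on borel.

Definition invariant_measure (Phi : M * R -> M)
    (mu : {finite_measure set borel -> \bar R}) : Prop :=
  forall t (A : set borel), measurable A ->
    mu ((fun p => Phi (p, t)) @^-1` A) = mu A.

(** The property characterising [A_mu] among the classes of [homology1 R M];
    [mu] is meant to be invariant under the flow of [V]. *)
Definition asymptotic_cycle V (mu : {finite_measure set borel -> \bar R})
    (A : homology1 R M) : Prop :=
  forall xi w, closed_form w -> in_class w xi ->
    (kronecker xi A)%:E = (\int[mu]_(p in [set: borel]) (contraction V w p)%:E)%E.

End manifold.

(* Main.v *)
(** The contraction of a Lyapunov form with [V] is negative off [Y] and zero on
    [Y], because the form vanishes there; it is continuous, hence Borel, and
    [<xi, A_mu>] is its integral against [mu].  On the neighbourhood [U] of [Y]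
    where the form is [df], a primitive along a path differs from [f] by a
    locally constant, hence constant, function, so the integration cocycle
    restricted to [U] is the coboundary of [f] seen as a 0-cochain. *)

Require Import Defs.
From mathcomp Require Import all_boot all_order all_algebra.
From mathcomp Require Import all_classical all_reals all_analysis.
From mathcomp Require Import lra.

Set Implicit Arguments.
Unset Strict Implicit.
Unset Printing Implicit Defensive.

Import Order.TTheory GRing.Theory Num.Theory.
Import numFieldNormedType.Exports.
Local Open Scope classical_set_scope.
Local Open Scope ring_scope.

(** * Vanishing partial derivatives *)

Lemma is_derive_line (R : realType) (U : normedModType R) (g : U -> R)
    (z v : U) (t d : R) :
  is_derive (z + t *: v) v g d ->
  is_derive t (1 : R) (fun s => g (z + s *: v)) d.
Proof.
(* Both derivatives are limits of one and the same difference quotient. *)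
have quotE : (fun h : R => h^-1 *:
      (((fun s => g (z + s *: v)) \o shift t) (h *: (1 : R)) -
        g (z + t *: v))) =
    (fun h : R => h^-1 *: ((g \o shift (z + t *: v)) (h *: v) -
        g (z + t *: v))).
  apply/funext => h /=.
  by rewrite [h *: (1 : R)]mulr1 scalerDl addrCA.
by case=> dg gd; split; [rewrite /derivable quotE | rewrite /derive quotE].
Qed.

(** The mean value theorem on the segment between [a] and [b]; [min] and [max] let a coordinate move
    either up or down. *)
Lemma is_derive0_eq (R : realType) (g : R -> R) (a b : R) :
  (forall t, Num.min a b <= t <= Num.max a b -> is_derive t (1 : R) g 0) ->
  g a = g b.
Proof.
wlog ab : a b / a <= b => [wlogH|].
  have /orP[|ba] := le_total a b; first exact: wlogH.
  by move=> dg; apply/esym/wlogH => // t; rewrite minC maxC; apply: dg.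
rewrite min_l// max_r// => dg.
have [||c _] := @MVT_segment R g (fun=> 0) a b ab.
- by move=> t tab; apply: dg; rewrite !ltW ?(itvP tab).
- apply: derivable_within_continuous => t tab.
  by have [] := dg t; rewrite ?(itvP tab).
by rewrite mul0r => /eqP; rewrite subr_eq0 => /eqP.
Qed.

(* The ball of the sup norm is a cube, so its points are joined to the centre by
    paths along the axes; this avoids differentiability in the total sense. *)
Lemma partials0_ball_cst (R : realType) (n : nat) (g : 'rV[R]_n -> R)
    (x y : 'rV[R]_n) (e : R) :
  (forall z i, ball x e z -> is_derive z (basis_vec R i) g 0) ->
  ball x e y -> g x = g y.
Proof.
move=> dg [e0 xy].
pose z k : 'rV[R]_n := \row_j (if (j < k)%N then y ord0 j else x ord0 j).
have zx : z 0 = x by apply/rowP => j; rewrite mxE.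
have zy : z n = y by apply/rowP => j; rewrite mxE ltn_ord.
suff H k : (k <= n)%N -> g x = g (z k) by rewrite (H n)// zy.
elim: k => [|k IH kn]; first by rewrite zx.
rewrite IH 1?ltnW//.
pose i := Ordinal kn; pose d := y ord0 i - x ord0 i.
have -> : z k.+1 = z k + d *: basis_vec R i.
  apply/rowP => j; rewrite !mxE eqxx /= ltnS.
  have [->|ji] := eqVneq j i.
    by rewrite /= leqnn ltnn mulr1 /d addrC subrK.
  rewrite mulr0 addr0 leq_eqVlt.
  by have -> : (j == k :> nat) = false by exact: negbTE.
rewrite -[in LHS](addr0 (z k)) -(scale0r (basis_vec R i)).
apply: (@is_derive0_eq _ (fun t => g (z k + t *: basis_vec R i))) => t td.
apply/is_derive_line/dg.
(* Coordinates other than [i] agree with [x] or [y]; coordinate [i] lies between the two, so it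
   stays within [e] of [x]. *)
split=> // a j; rewrite ord1 {a} !mxE eqxx /=.
have xyj := xy ord0 j; have [ji|ji] := eqVneq j i; last first.
  rewrite mulr0 addr0; case: ifP => // _; exact: ballxx.
rewrite ji /= ltnn mulr1; have := xy ord0 i; move: td; rewrite /ball /= /d.
rewrite !ltr_norml minElt maxElt => tI /andP[l1 l2].
move: tI; case: ltP => xyi /andP[t0 t1]; apply/andP; split; lra.
Qed.

(** * Charts as local homeomorphisms *)

Section charts.
Variables (R : realType) (n : nat) (X : topologicalType) (c : chart R n X).

Lemma dom_open : open (dom c). Proof. by case: c. Qed.

Lemma coordK p : dom c p -> param c (Defs.coord c p) = p.
Proof. by move=> cp; case: c cp => D x h /= _ _ xK _ _ /mem_set; apply: xK. Qed.

Lemma coord_continuous_at p : dom c p -> {for p, continuous (Defs.coord c)}.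
Proof.
case: c => D x h /= oD _ _ + _ Dp.
by rewrite continuous_open_subspace// => /(_ p (mem_set Dp)).
Qed.

Lemma param_continuous_at p :
  dom c p -> {for Defs.coord c p, continuous (param c)}.
Proof.
case: c => D x h /= _ oxD _ _ + Dp.
rewrite continuous_open_subspace// => /(_ (x p)); apply.
by apply/mem_set; exists p.
Qed.

Lemma nbhs_coord p (U : set X) : dom c p -> nbhs p U ->
  nbhs (Defs.coord c p) (Defs.coord c @` (dom c `&` U)).
Proof.
move=> cp pU; have oc : open (Defs.coord c @` dom c) by case: c.
have : nbhs (Defs.coord c p) (param c @^-1` U).
  by apply: param_continuous_at => //; rewrite coordK.
have : nbhs (Defs.coord c p) (Defs.coord c @` dom c).
  by apply: open_nbhs_nbhs; split => //; exists p.
apply: filterS2 => _ [q cq <-]; rewrite /= coordK// => Uq.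
by exists q.
Qed.

End charts.

(** * Local primitives and the contraction *)

Section forms.
Variables (R : realType) (n : nat) (M : closedManifold R n).
Implicit Types (p : M) (w : oneForm M) (V : vectorField M).

Lemma primitive_derive w (U : set M) (f : M -> R) (i : Defs.index M) p k :
  primitive_on U w f -> dom (atlas i) p -> U p ->
  is_derive (Defs.coord (atlas i) p) (basis_vec R k) (f \o param (atlas i))
    (form_comp w i p k ord0).
Proof.
move=> [sf wf] ip Up; split; last by rewrite wf// mxE.
(* At [[::]], [smooth_on] says that [f] itself, read in the chart, is derivable along each basis
   vector. *)
by have [] := sf i [::] (Defs.coord (atlas i) p) => //; exists p.
Qed.

(** In a chart both functions have the components of [w] as partial derivatives, so their difference
    has zero partials on a small cube. *)
Lemma primitive_sub_locally_cst w (U1 U2 : set M) (f1 f2 : M -> R) p :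
  open U1 -> open U2 -> U1 p -> U2 p ->
  primitive_on U1 w f1 -> primitive_on U2 w f2 ->
  \forall q \near p, f1 q - f2 q = f1 p - f2 p.
Proof.
move=> oU1 oU2 U1p U2p wf1 wf2.
have ip := chart_atP p; set i := chart_at p in ip.
have pU : nbhs p (U1 `&` U2) by apply: open_nbhs_nbhs; split; [exact: openI|].
have /nbhs_ballP[e /= e0 eU] := nbhs_coord ip pU.
have pe : nbhs p (Defs.coord (atlas i) @^-1` ball (Defs.coord (atlas i) p) e).
  by apply: (coord_continuous_at ip); exact: nbhsx_ballx.
have pi : nbhs p (dom (atlas i)).
  by apply: open_nbhs_nbhs; split => //; exact: dom_open.
apply: filterS2 pe pi => q /= qe iq.
pose g := (f1 \o param (atlas i)) - (f2 \o param (atlas i)).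
have dg z k : ball (Defs.coord (atlas i) p) e z ->
    is_derive z (basis_vec R k) g 0.
  move=> /eU[q' [iq' [U1q' U2q']] <-].
  rewrite -(subrr (form_comp w i q' k ord0)).
  by apply: is_deriveB; [apply: primitive_derive wf1 _ _|
                         apply: primitive_derive wf2 _ _].
have := partials0_ball_cst dg qe; rewrite /g.
by rewrite ![(_ - _ : _ -> _) _]/(_ - _) /= !coordK.
Qed.

(** The Jacobian from the change of vectors is absorbed by the change of covectors. *)
Lemma contractionE V w (i : Defs.index M) p : dom (atlas i) p ->
  Defs.contraction V w p = (vf_comp V i p *m form_comp w i p) ord0 ord0.
Proof.
move=> ip; have jp := chart_atP p; rewrite /Defs.contraction.
by rewrite (vf_change V ip jp) -mulmxA -(form_change w ip jp).
Qed.

Lemma contraction_continuous V w : continuous (Defs.contraction V w : M -> R).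
Proof.
move=> p; have ip := chart_atP p; set i := chart_at p in ip.
(* [contraction] uses a chart that varies with the point; [g] computes it near [p] in the single
   chart [i], where the components are continuous. *)
pose g (y : 'rV[R]_n) := \sum_k (vf_comp V i (param (atlas i) y) ord0 k *
  form_comp w i (param (atlas i) y) k ord0).
have ge q : dom (atlas i) q ->
    g (Defs.coord (atlas i) q) = Defs.contraction V w q.
  by move=> iq; rewrite (contractionE _ _ iq) mxE /g coordK.
have gc : {for Defs.coord (atlas i) p, continuous g}.
  have xp : (Defs.coord (atlas i) @` dom (atlas i)) (Defs.coord (atlas i) p).
    by exists p.
  rewrite /g; apply: cvg_big => [||k _].
  - exact: add_continuous.
  - exact: nbhs_filter.
  have [vc _] := @vf_smooth _ _ _ V i k [::] _ xp.
  have [wc _] := @form_smooth _ _ _ w i k [::] _ xp.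
  exact: cvgM vc wc.
have /(cvg_trans _) : g (Defs.coord (atlas i) q) @[q --> p] -->
    Defs.contraction V w p.
  rewrite -(ge p ip); exact: (continuous_comp (coord_continuous_at ip) gc).
apply; apply: near_eq_cvg.
have : nbhs p (dom (atlas i)).
  by apply: open_nbhs_nbhs; split => //; exact: dom_open.
by apply: filterS => q /ge.
Qed.

Lemma lyapunov_contraction_eq0 V w (Y : set M) p :
  lyapunov_form V Y w -> Y p -> Defs.contraction V w p = 0.
Proof.
move=> [_ _ [U [f [oU YU wf f0]]]] Yp; have ip := chart_atP p.
by rewrite /Defs.contraction wf.2 ?f0 ?mulmx0 ?mxE//; exact: YU.
Qed.

Lemma lyapunov_contraction_le0 V w (Y : set M) p :
  lyapunov_form V Y w -> Defs.contraction V w p <= 0.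
Proof.
move=> lw; have [Yp|/[dup] nYp] := pselect (Y p).
  by rewrite (lyapunov_contraction_eq0 lw Yp).
by case: lw => _ w0 _ /w0/ltW.
Qed.

End forms.

(** * The 1-simplex as an interval *)

Section segment.
Variable R : realType.

(** Clamping extends the parametrization of the 1-simplex to all of [R], so that calculus on the
    whole line applies. *)
Definition clamp (t : R) : R := Num.max 0 (Num.min 1 t).

Definition segment_fun (t : R) : 'rV[R]_2 :=
  \row_j (if j == ord0 then 1 - clamp t else clamp t).

Fact segment_subproof (t : R) : segment_fun t \in simplex R 1.
Proof.
have t0 : 0 <= clamp t by rewrite /clamp le_max lexx.
have t1 : clamp t <= 1 by rewrite /clamp ge_max ler01 ge_min lexx.
apply/mem_set; split=> [j|]; first by rewrite mxE; case: ifP; rewrite ?subr_ge0.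
by rewrite big_ord_recl big_ord1 !mxE /= subrK.
Qed.

Definition segment (t : R) : simplex R 1 :=
  exist _ (segment_fun t) (segment_subproof t).

Lemma segment0 : segment 0 = vertex R ord0.
Proof.
apply/val_inj/rowP => j; rewrite !mxE /clamp min_r ?ler01// maxxx subr0.
by case: ifP.
Qed.

Lemma segment1 : segment 1 = vertex R ord_max.
Proof.
apply/val_inj/rowP => j; rewrite !mxE /clamp minxx max_r ?ler01// subrr.
by case: j => [[|[|j]] jlt].
Qed.

Lemma segment_continuous : continuous segment.
Proof.
apply: continuous_comp_initial => t A [P Pt PA].
have cc : {for t, continuous (clamp : R -> R^o)}.
  apply: continuous_max; first exact: cvg_cst.
  by apply: continuous_min; [exact: cvg_cst|exact: cvg_id].
have cj a j : (fun s => segment_fun s a j) @ t --> segment_fun t a j.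
  rewrite /segment_fun mxE; under eq_fun do rewrite mxE.
  by case: ifP => _ //; apply: cvgB => //; exact: cvg_cst.
have : \forall s \near t, forall a j, P a j (segment_fun s a j).
  apply: (filter_forall (F := nbhs t)) => a.
  by apply: (filter_forall (F := nbhs t)) => j; apply/cj/Pt.
by apply: filterS => s Ps; apply: PA.
Qed.

(** Composed with [segment], the function has derivative zero on the whole line, hence is
    constant. *)
Lemma locally_cst_simplex1 (h : simplex R 1 -> R) :
  (forall t, \forall t' \near t, h t' = h t) ->
  h (vertex R ord_max) = h (vertex R ord0).
Proof.
move=> hc; rewrite -segment0 -segment1.
apply: (@is_derive_0_is_cst _ (h \o segment)) => t.
apply: near_eq_is_derive (is_derive_cst (h (segment t)) _ _).
have hct : \forall s \near t, h (segment s) = h (segment t).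
  exact: segment_continuous (hc (segment t)).
by apply: filterS hct => s /= ->.
Qed.

End segment.

(** Face 0 omits vertex 0, so it is the end point; this fixes the sign in the coboundary of a
    0-cochain. *)
Lemma face0_vertex (R : realType) :
  face R ord0 (vertex R (ord0 : 'I_1)) = vertex R ord_max.
Proof.
apply/val_inj/rowP => j; rewrite !mxE.
by case: unliftP => [l ->|->]; rewrite ?ord1 ?mxE.
Qed.

Lemma face1_vertex (R : realType) :
  face R (lift ord0 ord0) (vertex R (ord0 : 'I_1)) = vertex R ord0.
Proof.
apply/val_inj/rowP => j; rewrite !mxE.
by case: unliftP => [l ->|->]; rewrite ?ord1 ?mxE.
Qed.

(** * Exactness of the restricted class *)

Lemma homology_eqP (U V W : zmodType) (a : {additive U -> V})
    (b : {additive V -> W}) (v w : cycles b) :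
  (\pi_(homology a b) v = \pi_(homology a b) w)%qT <->
  exists u, val v - val w = a u.
Proof.
split=> [/(@eqmodP _ (cycle_equiv_rel a b))/asboolP//|vw].
exact/(@eqmodP _ (cycle_equiv_rel a b))/asboolP.
Qed.

Section exactness.
Variables (R : realType) (n : nat) (M : closedManifold R n).
Implicit Types (w : oneForm M) (U : set M) (f : M -> R).

(** Both [F] and [f \o s] come from local primitives of [w] along [s], so they differ by a locally
    constant function on the simplex. *)
Lemma path_integral_primitive w U f (s : singular R 1 M) a :
  open U -> primitive_on U w f -> (forall t, U (s t)) -> path_integral w s a ->
  a = f (s (vertex R ord_max)) - f (s (vertex R ord0)).
Proof.
move=> oU wf sU [F wF ->].
have Fs t : \forall t' \near t, F t' - f (s t') = F t - f (s t).
  have [U' [f' [oU' U't wf' Ff']]] := wF t.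
  have s_cts : {for t, continuous s} by exact: cts_fun.
  have ff' : \forall t' \near t, f' (s t') - f (s t') = f' (s t) - f (s t).
    exact: s_cts (primitive_sub_locally_cst oU' oU U't (sU t) wf' wf).
  by rewrite (nbhs_singleton Ff'); apply: filterS2 Ff' ff' => t' ->.
have := locally_cst_simplex1 Fs; lra.
Qed.

Lemma restriction_exact w U f (xi : cohomology1 R M) :
  open U -> primitive_on U w f -> in_class w xi ->
  restriction U xi = homology0 _ _.
Proof.
move=> oU wf [z xiz wz]; pose iU := inclusion U.
have /homology_eqP[u zu] : (\pi_(cohomology1 R M) (repr xi) =
    \pi_(cohomology1 R M) z)%qT by rewrite reprK.
pose g : cochain R U 0 := fun s => f (iU (s (vertex R ord0))).
(* [repr xi] may differ from the integration cocycle [z] by the coboundary of [u]; since [g] bounds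
   [z] on [U], the sum bounds [repr xi] there. *)
apply/homology_eqP; exists (pull_cochain iU u + g).
rewrite raddfD /= subr0; apply/funext => s.
have zus := congr1 (fun c : cochain R M 1 => c (comp_cts iU s)) zu.
have zs : val z (comp_cts iU s) =
    f (iU (s (vertex R ord_max))) - f (iU (s (vertex R ord0))).
  apply: path_integral_primitive oU wf _ (wz _) => t.
  exact: set_mem (valP (s t)).
have gs : coboundary g s =
    f (iU (s (vertex R ord_max))) - f (iU (s (vertex R ord0))).
  rewrite /coboundary !big_ord_recl big_ord0 addr0 /= expr0 expr1 mul1r mulN1r.
  by rewrite /g -face0_vertex -face1_vertex.
have us : coboundary (pull_cochain iU u) s = coboundary u (comp_cts iU s).
  apply: eq_bigr => i _; congr (_ * u _); exact/continuousEP.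
rewrite [RHS](_ : _ = coboundary (pull_cochain iU u) s + coboundary g s)//.
by rewrite us gs -zs -zus subrK.
Qed.

End exactness.

(** * Integrals of nonpositive functions and Borel measurability *)

Section measure.
Local Open Scope ereal_scope.
Context d (T : measurableType d) (R : realType).
Variable mu : {measure set T -> \bar R}.

(** Reduces to absolute values, whose integral vanishes exactly when the function is zero almost
    everywhere. *)
Lemma integral_le0N_abs (f : T -> R) : (forall x, (f x <= 0)%R) ->
  \int[mu]_x (f x)%:E = - \int[mu]_x `|(f x)%:E|.
Proof.
move=> f0; rewrite -integral_ge0N//; apply: eq_integral => x _.
by rewrite abse_EFin ler0_norm// EFinN oppeK.
Qed.

Lemma integral_le0_eq0P (f : T -> R) :
  measurable_fun [set: T] f -> (forall x, (f x <= 0)%R) ->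
  \int[mu]_x (f x)%:E = 0 <-> mu [set x | f x != 0%R] = 0.
Proof.
move=> mf f0; rewrite integral_le0N_abs//.
have /measurable_realfun.measurable_EFinP mEf := mf.
have mneq0 : measurable [set x | f x != 0%R].
  have := measurable_realfun.emeasurable_neq measurableT mEf 0.
  by rewrite setTI.
(* Almost everywhere equality is negligibility of this complement, which for a measurable set means
   measure zero. *)
have negE : ~` [set x | [set: T] x -> (EFin \o f) x = cst 0 x] =
    [set x | f x != 0%R].
  apply/seteqP; split=> x /= fx.
    by apply/eqP => fx0; apply: fx; rewrite fx0.
  by move=> /(_ Logic.I)[fx0]; rewrite fx0 eqxx in fx.
rewrite -(negligibleP mu mneq0) -negE.
apply: iff_trans (ae_eq_integral_abs mu measurableT mEf).
by split=> [/eqP|->]; rewrite ?oppe0// oppe_eq0 => /eqP.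
Qed.

End measure.

(** Open intervals generate the Borel sets of [R], and their preimages are open, hence generators of
    the sigma-algebra of [borel M]. *)
Lemma continuous_borel_measurable (R : realType) n (M : closedManifold R n)
    (f : M -> R) :
  continuous f -> measurable_fun [set: borel M] (f : borel M -> R).
Proof.
move=> cf.
apply: (measurability _ (measurable_realfun.RGenOpens.measurableE R)) => //.
move=> _ [_ [a [b ->]] <-]; rewrite setTI; apply: sub_sigma_algebra.
by move/continuousP: cf; apply; exact: interval_open.
Qed.

Theorem proposition1 (R : realType) (n : nat) (M : closedManifold R n)
    (V : vectorField M) (Phi : M * R -> M) (Y : set M)
    (xi : cohomology1 R M) :
  flow_generated_by V Phi ->
  closed Y ->
  flow_invariant Phi Y ->
  (exists w : oneForm M, lyapunov_form V Y w /\ in_class w xi) ->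
  (forall (mu : {finite_measure set (borel M) -> \bar R}) (A : homology1 R M),
     invariant_measure Phi mu ->
     asymptotic_cycle V mu A ->
     kronecker xi A <= 0 /\
     (kronecker xi A = 0 <-> mu (~` Y) = 0%E)) /\
  cech_restriction_eq0 xi Y.
Proof.
move=> _ _ _ [w [lw wxi]]; split=> [mu A _ mA|]; last first.
  by have [_ _ [U [f [oU YU wf _]]]] := lw; exists U; split => //;
    exact: restriction_exact wf wxi.
have [cw neg _] := lw; have kE := mA xi w cw wxi.
have mc := continuous_borel_measurable (@contraction_continuous _ _ _ V w).
have c0 p := lyapunov_contraction_le0 p lw.
(* The two Lyapunov conditions together make [Y] exactly the zero set of the contraction. *)
have cY : [set p | Defs.contraction V w p != 0] = ~` Y.
  apply/seteqP; split=> p /=; last by move/neg/lt_eqF/negbT.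
  by move=> /eqP cp /(lyapunov_contraction_eq0 lw).
split.
  by rewrite -lee_fin kE integral_le0N_abs// oppe_le0 integral_ge0.
(* [kE] equates extended reals; injectivity of [EFin] brings the equality back to [R]. *)
by rewrite -cY -(integral_le0_eq0P mu mc c0) -kE; split=> [->|[]].
Qed.
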